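(* For every integer $d \geq 1$ there is a constant $c = c(d) > 0$, depending only on $d$, such that the following holds. Let $F$ be a finite field, let $n$ be a positive integer, let $0 \leq \beta \leq 1$, and let $\mathbf{L}$ be a collection (set) of lines in $F^n$ with $|\mathbf{L}| \geq |F|^{2(d-1)+\beta}$. Then $$\Big|\bigcup_{L \in \mathbf{L}} L\Big| \geq c\,|F|^{d+\beta}.$$
   Context: $|\cdot|$ denotes cardinality. A line in $F^n$ is a translate of a one-dimensional linear subspace of $F^n$ (an affine line), regarded as a set of points. *)

(* Defs.v *)
From HB Require Import structures.
From mathcomp Require Import all_boot all_order all_algebra.

Set Implicit Arguments.
Unset Strict Implicit.
Unset Printing Implicit Defensive.

Import GRing.Theory.
Local Open Scope ring_scope.

Definition is_line (F : finFieldType) (n : nat) (L : {set 'rV[F]_n}) : Prop :=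
  exists (p : 'rV[F]_n) (U : {vspace 'rV[F]_n}),
    \dim U = 1%N /\ L = [set p + u | u in U].

(* Main.v *)
Require Import Defs.
From mathcomp Require Import all_boot all_order all_algebra.
From mathcomp Require Import zify ring.
From mathcomp Require Import reals exp.

Set Implicit Arguments.
Unset Strict Implicit.
Unset Printing Implicit Defensive.

Import Order.TTheory GRing.Theory Num.Theory.

(** Let [q] be the order of the field, [N] the number of lines and [P] a set of
    points.  The proof establishes the following inequality free of real
    exponents, for lines which need only be partly contained in [P]: if each
    of the [N] lines has at least [q / m] points in [P], then
    [min (N q^2) (q^(2d+1)) <= C |P| q^d] with [C] depending on [d] and [m] only
    ([union_bound], [union_bound_exists]).  When [N >= q^(2(d-1)+beta)] and
    [beta <= 1], both terms of the minimum are at least [q^(2d+beta)], whence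
    the theorem.

    The inequality is proved by strong induction on [d]; one may assume
    [N <= q^(2d-1)].  Call a [k]-flat rich if it contains at least [q^(2k-3)] of
    the lines.  By the bound for [k-1], a rich [k]-flat meets [P] in a positive
    proportion of its [q^k] points ([rich_card]).

    Top dimension.  If at least half of the lines lie in rich [d]-flats, then,
    as a [d]-flat contains at most [2 q^(2d-2)] lines, there are many rich
    [d]-flats.  They have about [q^d] points of [P] each and pairwise
    intersections of size at most [q^(d-1)], so that about [q] of them are
    almost disjoint, and their union has the right size ([greedy]).
    Otherwise one continues with the lines outside the rich [d]-flats.

    Lower dimensions ([stage]).  Suppose that no [(k+1)-flat] is rich, [k < d].
    Discard the points of [P] whose degree is far below the average [N q / |P|],
    and then the lines that have lost half of their points; at least half of
    the lines survive ([refinement]).  If some [k]-flat [S] is rich for the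
    surviving lines, it has about [q^k] popular points.  Either the average
    degree is at most a multiple of [q^(k-1)], the number of directions in [S],
    and then [|P|] is already large enough; or most lines through a
    popular point of [S] leave [S], and [S] is the spine of a hairbrush with
    about [q^k N q / |P|] hairs ([hairs_count]).  The hairs are distributed over
    the [(k+1)]-flats containing [S], which are disjoint outside [S].  None of
    these is rich, so the bound for [k] applies inside each at its linear
    regime, and summing gives [#hairs q^2 <= C |P| q^k] ([hairs_bound]).
    Together these yield [N q^3 <= C |P|^2], which is as strong as required
    because [N <= q^(2d-1)] ([hairbrush]).  If no [k]-flat is rich for the
    surviving lines, one goes on with these lines and [k-1].  The descent ends
    since each single line is a rich [1]-flat. *)

(** * Affine flats over a finite field *)

(** Kept as a constant so that arithmetic tactics see a single atom, whichever
    of the structures of [F] the cardinality is computed from. *)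
Definition field_order (F : finFieldType) : nat := #|F|.

Section Flats.
Variables (F : finFieldType) (n : nat).
Local Notation V := 'rV[F]_n.
Local Notation q := (field_order F).
Implicit Types (S T W L P : {set V}) (Ls : {set {set V}}).

(** Dimension is read off the cardinality, so that no linear algebra is needed:
    the ternary closure condition gives translates of subspaces over every
    field, including the field with two elements, where closure under
    two-point affine combinations is vacuous. *)
Definition affine S :=
  [forall x in S, forall y in S, forall z in S, forall a : F,
     (x + a *: (y - z))%R \in S].

Definition flat k S := (#|S| == q ^ k) && affine S.

Lemma affineP S :
  reflect (forall x y z (a : F), x \in S -> y \in S -> z \in S ->
             (x + a *: (y - z))%R \in S) (affine S).
Proof.
apply: (iffP forall_inP) => [H x y z a xS yS zS | H x xS].
  by move/forall_inP/(_ y yS)/forall_inP/(_ z zS)/forallP: (H x xS) => /(_ a).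
apply/forall_inP => y yS; apply/forall_inP => z zS; apply/forallP => a.
exact: H.
Qed.

Lemma field_gt1 : 1 < q.
Proof. exact: card_finNzRing_gt1. Qed.

Lemma field_pow_gt0 k : 0 < q ^ k.
Proof. by rewrite expn_gt0 (ltnW field_gt1). Qed.

Lemma flat_card k S : flat k S -> #|S| = q ^ k.
Proof. by case/andP => /eqP. Qed.

Lemma flat_affine k S : flat k S -> affine S.
Proof. by case/andP. Qed.

Lemma affine1 (x : V) : affine [set x].
Proof.
by apply/affineP => y z w a /set1P -> /set1P -> /set1P ->; rewrite subrr scaler0 addr0 set11.
Qed.

Lemma affineI S T : affine S -> affine T -> affine (S :&: T).
Proof.
move=> /affineP aS /affineP aT; apply/affineP => x y z a.
by move=> /setIP[? ?] /setIP[? ?] /setIP[? ?]; rewrite inE aS // aT.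
Qed.

(** For [x0] in [S] and [x] outside it, [sweep S (x - x0)] is the affine span of
    [S] and [x]. *)
Definition sweep S (v : V) := [set (u.1 + u.2 *: v)%R | u in setX S [set: F]].

Lemma sweep_affine S v : affine S -> affine (sweep S v).
Proof.
move=> /affineP aS; apply/affineP => x y z a.
move=> /imsetP[[s1 b1] /setXP[/= h1 _] ->] /imsetP[[s2 b2] /setXP[/= h2 _] ->].
move=> /imsetP[[s3 b3] /setXP[/= h3 _] ->] /=.
apply/imsetP; exists ((s1 + a *: (s2 - s3))%R, (b1 + a * (b2 - b3))%R) => /=.
  by rewrite !inE /= aS.
by apply/rowP => i; rewrite !mxE; ring.
Qed.

(** Two parallel copies of [S] that share a point would put a nonzero multiple of
    [x - x0] among the differences of points of [S], and hence [x] in [S]. *)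
Lemma card_sweep S (x0 x : V) : affine S -> x0 \in S -> x \notin S ->
  #|sweep S (x - x0)| = q * #|S|.
Proof.
move=> /affineP aS x0S xS; rewrite card_in_imset ?cardsX ?cardsT 1?mulnC //.
move=> [s a] [t b] /setXP[/= sS _] /setXP[/= tS _] e.
have [ab|ab] := eqVneq a b; first by move: e; rewrite ab => /addIr ->.
case/negP: xS.
have ab0 : (a - b != 0)%R by rewrite subr_eq0.
have e1 : (t - s = (a - b) *: (x - x0))%R.
  rewrite scalerBl; apply/eqP; rewrite subr_eq addrAC -subr_eq opprK.
  by rewrite addrC eq_sym -e addrC.
have -> : x = (x0 + (a - b)^-1 *: (t - s))%R.
  by rewrite e1 scalerA mulVf // scale1r addrC subrK.
exact: aS.
Qed.

Lemma sweep_sub S v : S \subset sweep S v.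
Proof.
apply/subsetP => s sS; apply/imsetP; exists (s, 0%R); first by rewrite !inE sS.
by rewrite /= scale0r addr0.
Qed.

Lemma sweep_mem S (x0 x : V) : x0 \in S -> x \in sweep S (x - x0).
Proof.
move=> x0S; apply/imsetP; exists (x0, 1%R); first by rewrite !inE x0S.
by rewrite /= scale1r addrC subrK.
Qed.

Lemma sweep_min S W (x0 x : V) : affine W -> S \subset W -> x0 \in S -> x \in W ->
  sweep S (x - x0) \subset W.
Proof.
move=> /affineP aW /subsetP SW x0S xW; apply/subsetP => y /imsetP[[s a] /setXP[/= sS _] ->].
by rewrite aW // SW.
Qed.

(** A flat one dimension above [S] is spanned by [S] and any of its further points
    [x], by a comparison of cardinalities with the sweep.  This stands in for
    uniqueness of the affine span; with [S] a point it says that two points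
    determine a line. *)
Lemma flat_min k S T W (x : V) : flat k S -> flat k.+1 T -> S \subset T ->
  x \in T -> x \notin S -> affine W -> S \subset W -> x \in W -> T \subset W.
Proof.
move=> fS fT ST xT xS aW SW xW.
have /card_gt0P[x0 x0S] : 0 < #|S| by rewrite (flat_card fS) field_pow_gt0.
suff <- : sweep S (x - x0) = T by exact: sweep_min.
apply/eqP; rewrite eqEcard sweep_min ?(flat_affine fT) //=.
by rewrite card_sweep ?(flat_affine fS) // (flat_card fS) (flat_card fT) expnS.
Qed.

Lemma flat0 (x : V) : flat 0 [set x].
Proof. by rewrite /flat cards1 expn0 eqxx affine1. Qed.

Lemma line_min L W (x y : V) : flat 1 L -> affine W -> x \in L -> y \in L -> x != y ->
  x \in W -> y \in W -> L \subset W.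
Proof.
move=> fL aW xL yL xy xW yW; apply: (flat_min (flat0 x) fL _ yL) => //;
  by rewrite ?sub1set // inE eq_sym.
Qed.

Lemma line_meet_flat L W : flat 1 L -> affine W -> ~~ (L \subset W) -> #|L :&: W| <= 1.
Proof.
move=> fL aW LW; rewrite leqNgt; apply: contra LW => /card_gt1P[x [y [/setIP[xL xW] /setIP[yL yW] xy]]].
exact: (line_min fL aW xL yL).
Qed.

Lemma flat_join_line k S L (p : V) : flat k S -> flat 1 L -> p \in L -> p \in S ->
  ~~ (L \subset S) -> exists2 T, flat k.+1 T & (S \subset T) && (L \subset T).
Proof.
move=> fS fL pL pS /subsetPn[x xL xS]; have aS := flat_affine fS.
exists (sweep S (x - p)).
  by rewrite /flat sweep_affine // card_sweep // (flat_card fS) expnS eqxx.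
rewrite sweep_sub; apply: (line_min fL _ pL xL); rewrite ?sweep_affine ?sweep_mem //.
  by apply: contraNneq xS => <-.
by apply: (subsetP (sweep_sub _ _)).
Qed.

(** Sweeping the intersection towards a point of [S] outside [T] stays in [S] and
    multiplies the cardinality by [q]. *)
Lemma flat_meet k S T : flat k.+1 S -> flat k.+1 T -> S != T -> #|S :&: T| <= q ^ k.
Proof.
move=> fS fT ST; have [->|[x0 x0ST]] := set_0Vmem (S :&: T); first by rewrite cards0.
have aST := affineI (flat_affine fS) (flat_affine fT).
have /subsetPn[x xS xT] : ~~ (S \subset T).
  by apply: contra ST => ST; rewrite eqEcard ST (flat_card fS) (flat_card fT) /=.
rewrite -(leq_pmul2l (ltnW field_gt1)) -expnS -(flat_card fS).
rewrite -(card_sweep aST x0ST (x := x)); last by rewrite inE negb_and xT orbT.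
by apply/subset_leq_card/sweep_min; rewrite ?(flat_affine fS) ?subsetIl.
Qed.

(** * Counting incidences in a flat *)

Definition through Ls (p : V) := [set L in Ls | p \in L].
Definition inside Ls S := [set L in Ls | L \subset S].

Lemma incidences Ls P : \sum_(L in Ls) #|L :&: P| = \sum_(p in P) #|through Ls p|.
Proof.
transitivity (\sum_(L in Ls) \sum_(p in P) (p \in L : nat)).
  apply: eq_bigr => L _; rewrite -sum1_card big_mkcond [RHS]big_mkcond /=.
  by apply: eq_bigr => p _; rewrite inE andbC; do 2!case: (_ \in _).
rewrite exchange_big; apply: eq_bigr => p _; rewrite -sum1_card.
rewrite big_mkcond [RHS]big_mkcond /=.
by apply: eq_bigr => L _; rewrite inE; do 2!case: (_ \in _).
Qed.

(** Away from [p] the lines through [p] are disjoint and have [q - 1] points each,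
    and [2 (q - 1) >= q]. *)
Lemma pencil_bound k S Ls (p : V) : flat k S ->
  {in Ls, forall L, flat 1 L /\ L \subset S} -> {in Ls, forall L, p \in L} ->
  #|Ls| * q <= 2 * q ^ k.
Proof.
move=> fS HL Hp; have q1 := field_gt1.
have H1 : \sum_(L in Ls) #|L :&: (S :\ p)| = #|Ls| * q.-1.
  rewrite -sum_nat_const; apply: eq_bigr => L LLs; have [fL LS] := HL L LLs.
  rewrite setIDA (setIidPl LS); have := cardsD1 p L.
  by rewrite (Hp L LLs) (flat_card fL) expn1 => ->.
have H2 : \sum_(x in S :\ p) #|through Ls x| <= #|S|.
  apply: leq_trans (_ : #|S :\ p| <= _); last exact/subset_leq_card/subD1set.
  rewrite -sum1_card; apply: leq_sum => x /setD1P[xp _].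
  rewrite leqNgt; apply/negP => /card_gt1P[L [L' [/setIdP[LL xL] /setIdP[LL' xL'] /negP LneL']]].
  apply: LneL'; rewrite eqEcard (flat_card (HL _ LL).1) (flat_card (HL _ LL').1) leqnn andbT.
  by apply: (line_min (HL _ LL).1 (flat_affine (HL _ LL').1) xL (Hp _ LL) xp) => //; exact: Hp.
rewrite -incidences H1 (flat_card fS) in H2; nia.
Qed.

Lemma inside_bound k S Ls : flat k S -> {in Ls, forall L, flat 1 L} ->
  #|inside Ls S| * q ^ 2 <= 2 * q ^ k.*2.
Proof.
move=> fS HL; set Ls' := inside Ls S.
have H1 : \sum_(L in Ls') #|L :&: S| = #|Ls'| * q.
  rewrite -sum_nat_const; apply: eq_bigr => L /setIdP[LLs LS].
  by rewrite (setIidPl LS) (flat_card (HL _ LLs)) expn1.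
rewrite -mulnn mulnA -H1 incidences big_distrl /= -addnn expnD mulnA mulnC.
rewrite -[X in X * _](flat_card fS) -sum_nat_const; apply: leq_sum => p pS.
apply: (pencil_bound fS (p := p)) => L; last by case/setIdP.
by case/setIdP => /setIdP[LLs LS] _; split=> //; exact: HL.
Qed.

End Flats.

(** Adding the sets one at a time, each meets the union of the earlier ones in at
    most [b] points per earlier set.  The factor [c] lets the lower bound on the
    trace of the sets on [P] be a fraction of [a]. *)
Lemma card_bigcup_lower (T : finType) (s : seq {set T}) (P : {set T}) a b c :
  uniq s -> {in s, forall A, a <= c * #|P :&: A|} ->
  {in s &, forall A B, A != B -> #|A :&: B| <= b} ->
  size s * a <= c * (#|P :&: \bigcup_(A <- s) A| + size s * (size s).-1 * b).
Proof.
elim: s => [|A s IH] /=; first by rewrite !mul0n leq0n.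
case/andP => As us Ha Hb; rewrite big_cons setIUr.
set U := \bigcup_(B <- s) B in IH *.
have {}IH : size s * a <= c * (#|P :&: U| + size s * (size s).-1 * b).
  apply: IH => // [B Bs|B B' Bs Bs']; first by apply: Ha; rewrite inE Bs orbT.
  by apply: Hb; rewrite inE ?Bs ?Bs' orbT.
have HA : a <= c * #|P :&: A| by apply: Ha; rewrite inE eqxx.
have HAU : #|A :&: U| <= size s * b.
  have HB : {in s, forall B, #|A :&: B| <= b}.
    move=> B Bs; apply: Hb; rewrite ?inE ?eqxx ?Bs ?orbT //.
    by apply: contraNneq As => ->.
  rewrite /U; elim: (s) HB => [|B t IHt] HB; first by rewrite big_nil setI0 cards0.
  rewrite big_cons setIUr mulSn; apply: leq_trans (leq_card_setU _ _) _.
  by rewrite leq_add ?HB ?mem_head //; apply: IHt => C Ct; apply: HB; rewrite inE Ct orbT.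
have HI : #|(P :&: A) :&: (P :&: U)| <= size s * b.
  by apply: leq_trans HAU; apply/subset_leq_card/setISS; exact: subsetIr.
have := cardsUI (P :&: A) (P :&: U); nia.
Qed.

(** * The inequality and its first consequences *)

(** Lines of density at least [1 / m] in [P].  Allowing a density is what makes the
    induction close: it is applied to the lines after points of low degree, or
    the spine of a hairbrush, have been removed from them. *)
Definition shaded (F : finFieldType) (n m : nat) (P : {set 'rV[F]_n})
    (Ls : {set {set 'rV[F]_n}}) :=
  forall L, L \in Ls -> flat 1 L /\ field_order F <= m * #|L :&: P|.

(** At [d = 0] this only says that [P] has at least [q / C] points as soon as there
    is a line; starting there covers the rich flats of dimension one. *)
Definition union_bound d m C :=
  forall (F : finFieldType) n (P : {set 'rV[F]_n}) Ls, shaded m P Ls ->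
  minn (#|Ls| * field_order F ^ 2) (field_order F ^ d.*2.+1) <= C * (#|P| * field_order F ^ d).

(** The condition is [q^(2k-3) <= #|inside Ls S|], cleared of the negative
    exponent at [k = 1], where it holds as soon as [S] is a line of [Ls]. At this
    threshold the two terms of the minimum in [union_bound k.-1] are equal. *)
Definition rich (F : finFieldType) n k (Ls : {set {set 'rV[F]_n}}) (S : {set 'rV[F]_n}) :=
  flat k S && (field_order F ^ k.*2 <= #|inside Ls S| * field_order F ^ 3).

Lemma shaded_sub (F : finFieldType) n m (P : {set 'rV[F]_n}) (Ls Ls' : {set {set 'rV[F]_n}}) :
  Ls' \subset Ls -> shaded m P Ls -> shaded m P Ls'.
Proof. by move=> /subsetP sub HL L /sub /HL. Qed.

Lemma shaded_inside (F : finFieldType) n m (P S : {set 'rV[F]_n}) (Ls : {set {set 'rV[F]_n}}) :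
  shaded m P Ls -> shaded m (P :&: S) (inside Ls S).
Proof.
move=> HL L /setIdP[/HL[fL HP] LS]; split=> //.
by rewrite setICA (setIidPl LS) setIC.
Qed.

Lemma union_bound0 m : union_bound 0 m m.
Proof.
move=> F n P Ls HL; have [->|[L /HL[_ H]]] := set_0Vmem Ls; first by rewrite cards0 min0n.
rewrite muln1 double0 expn1; apply: leq_trans (geq_minr _ _) (leq_trans H _).
by rewrite leq_mul2l subset_leq_card ?subsetIr ?orbT.
Qed.

Lemma rich_card (F : finFieldType) n k m C (P S : {set 'rV[F]_n}) (Ls : {set {set 'rV[F]_n}}) :
  union_bound k m C -> shaded m P Ls -> rich k.+1 Ls S ->
  field_order F ^ k.+1 <= C * #|P :&: S|.
Proof.
move=> HC HL /andP[_]; rewrite doubleS; have q0 := field_pow_gt0 F 1.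
rewrite expn1 in q0.
rewrite (expnS _ 2) [X in _ <= X]mulnCA expnS leq_pmul2l // => Hr.
have := HC _ _ _ _ (shaded_inside (S := S) HL).
rewrite (minn_idPr Hr) mulnA -addnn -addSn expnD leq_pmul2r //.
exact: field_pow_gt0.
Qed.

(** The threshold is [1 / (4 m)] of the average degree [N q / #|P|]: low enough for
    the remaining points to carry less than half of the incidences guaranteed by
    [shaded m P Ls]. *)
Definition popular (F : finFieldType) n m (P : {set 'rV[F]_n}) (Ls : {set {set 'rV[F]_n}}) :=
  [set p in P | #|Ls| * field_order F <= 4 * m * #|P| * #|through Ls p|].

Definition popular_lines (F : finFieldType) n m (P : {set 'rV[F]_n})
    (Ls : {set {set 'rV[F]_n}}) :=
  [set L in Ls | field_order F <= 2 * m * #|L :&: popular m P Ls|].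

(** A discarded line has more than [q / (2 m)] of its points among the unpopular ones,
    whose total degree is at most [N q / (4 m)]. *)
Lemma refinement (F : finFieldType) n m (P : {set 'rV[F]_n}) (Ls : {set {set 'rV[F]_n}}) :
  shaded m P Ls -> #|Ls| <= 2 * #|popular_lines m P Ls|.
Proof.
set P' := popular m P Ls; set Ls' := popular_lines m P Ls.
move=> HL; have q1 := field_gt1 F.
have [P0|P0] := posnP #|P|.
  have [->|[L LL]] := set_0Vmem Ls; first by rewrite cards0.
  have [_] := HL L LL; have := subset_leq_card (subsetIr L P).
  by rewrite P0 leqn0 => /eqP ->; lia.
set N := #|Ls|; pose B := Ls :\: Ls'.
have cB : N = #|Ls'| + #|B|.
  by rewrite /N -(cardsID Ls' Ls) (setIidPr _) //; apply/subsetP => L /setIdP[].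
suff : #|P| * field_order F * (2 * #|B|) <= #|P| * field_order F * N.
  by rewrite leq_pmul2l ?muln_gt0 ?P0 ?(ltnW q1) // => h; lia.
have H1 : #|B| * field_order F <= 2 * m * \sum_(L in B) #|L :&: (P :\: P')|.
  rewrite -sum_nat_const big_distrr /=; apply: leq_sum => L /setDP[LL].
  rewrite inE LL /= -ltnNge => H; have [_] := HL L LL.
  have := cardsID P' (L :&: P); rewrite -setIA (setIidPr (_ : P' \subset P)).
    rewrite setIDA => <-; move: H; rewrite mulnDr -!mulnA; move: (m * _) (m * _) => a b; lia.
  by apply/subsetP => p /setIdP[].
have H2 : 4 * m * #|P| * \sum_(L in B) #|L :&: (P :\: P')| <= #|P| * (N * field_order F).
  rewrite incidences big_distrr /=.
  apply: leq_trans (_ : \sum_(p in P :\: P') N * field_order F <= _); last first.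
    by rewrite sum_nat_const leq_mul2r subset_leq_card ?orbT ?subsetDl.
  apply: leq_sum => p /setDP[pP]; rewrite inE pP /= -ltnNge => /ltnW.
  apply: leq_trans; rewrite leq_mul2l; apply/orP; right; apply: subset_leq_card.
  by apply/subsetP => L /setIdP[/setDP[LL _] pL]; rewrite inE LL.
nia.
Qed.

(** A line that meets [S] without lying in it spans with [S] a flat one dimension
    higher, and these flats partition the complement of [S].  In each, the bound
    of dimension [k] is applied to the points outside [S]; the lines lose one
    point each, which a large field absorbs by doubling [m].  As no such flat is
    rich, the minimum is attained by its linear term, and the bounds add up. *)
Lemma hairs_bound (F : finFieldType) n k m C (P S : {set 'rV[F]_n}) (Ls : {set {set 'rV[F]_n}}) :
  union_bound k (2 * m) C -> 2 * m <= field_order F -> shaded m P Ls -> flat k S ->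
  (forall T, ~~ rich k.+1 Ls T) ->
  #|[set L in Ls | ~~ (L \subset S) & ~~ [disjoint L & S]]| * field_order F ^ 2 <=
    C * (#|P| * field_order F ^ k).
Proof.
move=> HC qm HL fS nr; set H := [set L in _ | _].
pose TT := [set T : {set 'rV[F]_n} | flat k.+1 T & S \subset T].
have aS := flat_affine fS.
have HT (T : {set 'rV[F]_n}) : T \in TT ->
    #|inside H T| * field_order F ^ 2 <= C * (#|P :&: T :\: S| * field_order F ^ k).
  move=> /setIdP[fT ST].
  have := HC _ _ (P :&: T :\: S) (inside H T) _.
  rewrite (minn_idPl _); first apply.
    move=> L /setIdP[/setIdP[LL /andP[LS _]] LT]; have [fL] := HL L LL; split=> //.
    have -> : L :&: (P :&: T :\: S) = (L :&: P) :\: S.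
      by rewrite setIDA setIA setIAC (setIidPl LT).
    have := cardsID S (L :&: P).
    have := line_meet_flat fL aS LS.
    by have := subset_leq_card (setSI S (subsetIl L P)); nia.
  have := nr T; rewrite /rich fT /= -ltnNge => /ltnW h.
  have q0 : 0 < field_order F by exact: ltnW (field_gt1 F).
  rewrite -(leq_pmul2l q0) -expnS -doubleS; apply: leq_trans h.
  rewrite mulnCA -expnS leq_mul2r; apply/orP; right; apply: subset_leq_card.
  by apply/subsetP => L /setIdP[/setIdP[LL _] LT]; rewrite inE LL.
have H1 : #|H| <= \sum_(T in TT) #|inside H T|.
  have cov : H \subset \bigcup_(T in TT) inside H T.
    apply/subsetP => L LH; have /setIdP[LL /andP[LS]] := LH.
    rewrite -setI_eq0 => /set0Pn[p /setIP[pL pS]].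
    have [T fT /andP[ST LT]] := flat_join_line fS (HL L LL).1 pL pS LS.
    by apply/bigcupP; exists T; rewrite inE ?fT ?LH.
  apply: leq_trans (subset_leq_card cov) _.
  elim/big_rec2: _ => [|T a A _ IH]; first by rewrite cards0.
  by apply: leq_trans (leq_card_setU _ _) _; rewrite leq_add2l.
have H2 : \sum_(T in TT) #|P :&: T :\: S| <= #|P|.
  apply: (@leq_trans (\sum_(T in TT) \sum_(p in P) ((p \in T) && (p \notin S) : nat))).
    apply: eq_leq; apply: eq_bigr => T _; rewrite -sum1_card big_mkcond [RHS]big_mkcond /=.
    by apply: eq_bigr => p _; rewrite !inE; do 3!case: (_ \in _).
  rewrite exchange_big -sum1_card; apply: leq_sum => p pP.
  have [pS|pS] := boolP (p \in S); first by rewrite big1 // => T _; rewrite andbF.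
  rewrite -big_mkcondr /= sum1_card leqNgt; apply/negP.
  move=> /card_gt1P[T [T' [/andP[/setIdP[fT ST] /andP[pT _]] /andP[/setIdP[fT' ST'] /andP[pT' _]] /eqP[]]]].
  apply/eqP; rewrite eqEsubset.
  apply/andP; split.
    exact: flat_min fS fT ST pT pS (flat_affine fT') ST' pT'.
  exact: flat_min fS fT' ST' pT' pS (flat_affine fT) ST pT.
apply: leq_trans (_ : (\sum_(T in TT) #|inside H T|) * field_order F ^ 2 <= _).
  by rewrite leq_mul2r H1 orbT.
apply: leq_trans (_ : C * ((\sum_(T in TT) #|P :&: T :\: S|) * field_order F ^ k) <= _).
  by rewrite !big_distrl big_distrr; exact: leq_sum.
by rewrite leq_mul2l leq_mul2r H2 !orbT.
Qed.

(** * Hairbrushes whose spine is a flat *)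

(** The assumed strict inequality makes the degree of a popular point exceed twice the
    number of lines through it inside [S], so at least half of its lines are
    hairs.  A hair meets [S] only once, so hairs are not counted twice. *)
Lemma hairs_count (F : finFieldType) n k m (P S : {set 'rV[F]_n}) (Ls : {set {set 'rV[F]_n}}) :
  shaded m P Ls -> flat k.+1 S ->
  16 * m * #|P| * field_order F ^ k.+1 < #|Ls| * field_order F ^ 2 ->
  #|popular m P Ls :&: S| * (#|Ls| * field_order F) <=
    8 * m * #|P| * #|[set L in Ls | ~~ (L \subset S) & ~~ [disjoint L & S]]|.
Proof.
move=> HL fS big; set H := [set L in _ | _]; set P' := popular m P Ls.
have q0 : 0 < field_order F by exact: ltnW (field_gt1 F).
have aS := flat_affine fS.
have out p : p \in P' :&: S -> #|Ls| * field_order F <= 8 * m * #|P| * #|through H p|.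
  case/setIP=> /setIdP[pP deg] pS.
  have split_deg : #|through Ls p| = #|through (inside Ls S) p| + #|through H p|.
    rewrite -(cardsID (inside Ls S)); congr (_ + _); apply: eq_card => L; rewrite !inE.
      by case: (L \in Ls); case: (p \in L); case: (L \subset S).
    have [pL|pL] := boolP (p \in L); last by rewrite !andbF.
    have -> : ~~ [disjoint L & S] by rewrite -setI_eq0; apply/set0Pn; exists p; rewrite inE pL.
    by case: (L \in Ls); case: (L \subset S).
  have inb : #|through (inside Ls S) p| * field_order F <= 2 * field_order F ^ k.+1.
    apply: (pencil_bound fS (p := p)) => L /setIdP[] // /setIdP[LL LS] _.
    by split=> //; have [] := HL L LL.
  move: deg; rewrite split_deg mulnDr => deg.
  suff : 4 * m * #|P| * #|through (inside Ls S) p| * 2 <= #|Ls| * field_order F by lia.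
  rewrite -(leq_pmul2r q0) -[X in _ <= X]mulnA mulnn; apply: leq_trans (ltnW big).
  have := leq_mul (leqnn (8 * m * #|P|)) inb; lia.
rewrite -sum_nat_const; apply: leq_trans (leq_sum _ _) _; first exact: out.
rewrite -big_distrr /= leq_mul2l -incidences; apply/orP; right.
rewrite -sum1_card; apply: leq_sum => L /setIdP[LL /andP[LS _]].
apply: leq_trans (line_meet_flat (HL L LL).1 aS LS).
by apply: subset_leq_card; rewrite setISS // subsetIr.
Qed.

(** If the average degree is comparable to the number of directions in [S], the
    bound is immediate from [k < d]. Otherwise the lower and the upper bound for
    the number of hairs give [N q^3 <= A #|P|^2]; multiplying by
    [N q <= q^(2d)] makes both sides squares up to the constant [A]. *)
Lemma hairbrush (F : finFieldType) n k d m C0 C1 (P S : {set 'rV[F]_n}) (Ls : {set {set 'rV[F]_n}}) :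
  union_bound k (2 * m) C0 -> union_bound k.+1 (2 * m) C1 -> k < d ->
  2 * m <= field_order F -> shaded m P Ls ->
  #|Ls| * field_order F ^ 2 <= field_order F ^ d.*2.+1 ->
  (forall T, ~~ rich k.+2 Ls T) -> rich k.+1 (popular_lines m P Ls) S ->
  #|Ls| * field_order F ^ 2 <= (16 * m + 8 * m * C0 * C1) * (#|P| * field_order F ^ d).
Proof.
move=> HC0 HC1 kd qm HL Nd nr rS; have fS : flat k.+1 S by case/andP: rS.
have q0 : 0 < field_order F by exact: ltnW (field_gt1 F).
have [small|big] := leqP (#|Ls| * field_order F ^ 2) (16 * m * #|P| * field_order F ^ k.+1).
  apply: leq_trans small _; rewrite mulnDl; apply: leq_trans (leq_addr _ _).
  by rewrite -!mulnA !leq_mul2l leq_pexp2l ?orbT.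
have H1 : field_order F ^ k.+1 <= C0 * #|popular m P Ls :&: S|.
  apply: rich_card HC0 _ rS => L /setIdP[LL ?]; split=> //.
  by have [] := HL L LL.
have H2 := hairs_count HL fS big.
have H3 := hairs_bound HC1 qm HL fS nr.
move: H1 H2 H3; set H := #|finset _|; set p := #|_ :&: S|; set N := #|Ls| in Nd *.
set q := field_order F in q0 Nd *; set K := q ^ k.+1 => H1 H2 H3.
have H4 : N * q ^ 3 <= 8 * m * C0 * C1 * #|P| ^ 2.
  have K0 : 0 < K by rewrite /K expn_gt0 q0.
  rewrite -(leq_pmul2r K0).
  have h1 : K * (N * q) <= 8 * m * #|P| * C0 * H.
    by have := leq_mul H1 (leqnn (N * q)); have := leq_mul (leqnn C0) H2; lia.
  by have := leq_mul h1 (leqnn (q ^ 2)); have := leq_mul (leqnn (8 * m * #|P| * C0)) H3; lia.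
have H5 : N * q <= (q ^ d) ^ 2.
  rewrite -(leq_pmul2r q0) -expnM muln2 -expnSr; apply: leq_trans Nd.
  by rewrite -mulnA mulnn.
apply: leq_trans (_ : 8 * m * C0 * C1 * (#|P| * q ^ d) <= _); last by rewrite leq_mul2r leq_addl orbT.
rewrite -leq_sqr; set A := 8 * m * C0 * C1 in H4 *.
apply: leq_trans (_ : A * (#|P| * q ^ d) ^ 2 <= _); last first.
  by rewrite (expnMn A) leq_mul2r; case: (A) => [|a]; rewrite ?orbT // -mulnn leq_pmulr ?orbT.
have := leq_mul H4 H5; rewrite !expnMn; lia.
Qed.

Lemma small_field (F : finFieldType) n d m (P : {set 'rV[F]_n}) (Ls : {set {set 'rV[F]_n}}) :
  field_order F <= 2 * m -> shaded m P Ls ->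
  #|Ls| * field_order F ^ 2 <= field_order F ^ d.*2.+1 ->
  #|Ls| * field_order F ^ 2 <= (2 * m) ^ d.+1 * (#|P| * field_order F ^ d).
Proof.
move=> qm HL Nd; have [->|[L /HL[_ HP]]] := set_0Vmem Ls; first by rewrite cards0.
have q0 : 0 < field_order F by exact: ltnW (field_gt1 F).
have P0 : 0 < #|P|.
  rewrite lt0n; apply: contraTneq HP => P0; rewrite -ltnNge.
  by have := subset_leq_card (subsetIr L P); rewrite P0 leqn0 => /eqP ->; rewrite muln0.
apply: leq_trans Nd _; rewrite -addnn -addSn expnD leq_mul //.
  by rewrite leq_exp2r.
by rewrite leq_pmull.
Qed.

(** * Descent on the dimension of the rich flats *)

(** Induction on [k]: either a flat of dimension [k] is rich for the popular lines
    and carries a hairbrush, or at least half of the lines satisfy the hypothesis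
    one dimension lower. At [k = 0] there are no lines, since each line would be
    a rich flat. *)
Lemma stage d m :
  (forall k, k < d -> exists C, union_bound k (2 * m) C) ->
  forall k, k < d -> exists C, forall (F : finFieldType) n (P : {set 'rV[F]_n}) Ls,
    shaded m P Ls -> #|Ls| * field_order F ^ 2 <= field_order F ^ d.*2.+1 ->
    (forall T, ~~ rich k.+1 Ls T) ->
    #|Ls| * field_order F ^ 2 <= C * (#|P| * field_order F ^ d).
Proof.
move=> IH; elim=> [|k IHk] kd.
  exists 0 => F n P Ls HL _ nr; have [->|[L LL]] := set_0Vmem Ls; first by rewrite cards0.
  case/negP: (nr L); have [fL _] := HL L LL; rewrite /rich fL /=.
  rewrite (expnS _ 2) mulnCA; have : 0 < #|inside Ls L|.
    by apply/card_gt0P; exists L; rewrite inE LL /=.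
  have q0 : 0 < field_order F by exact: ltnW (field_gt1 F).
  move=> i0; rewrite mulnA -[X in X <= _]mul1n leq_mul2r; apply/orP; right.
  by rewrite muln_gt0 q0.
have [C0 HC0] := IH k (ltnW kd); have [C1 HC1] := IH k.+1 kd.
have [C HC] := IHk (ltnW kd).
exists ((2 * m) ^ d.+1 + (16 * m + 8 * m * C0 * C1) + 2 * C) => F n P Ls HL Nd nr.
have [qm|qm] := leqP (field_order F) (2 * m).
  apply: leq_trans (small_field qm HL Nd) _.
  by rewrite leq_mul2r -addnA leq_addr orbT.
have [/existsP[S rS]|/existsPn nr'] := boolP [exists S, rich k.+1 (popular_lines m P Ls) S].
  apply: leq_trans (hairbrush HC0 HC1 (ltnW kd) (ltnW qm) HL Nd nr rS) _.
  by rewrite leq_mul2r addnAC leq_addl orbT.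
have sub : popular_lines m P Ls \subset Ls by apply/subsetP => L /setIdP[].
have ref := refinement HL.
have Nd' : #|popular_lines m P Ls| * field_order F ^ 2 <= field_order F ^ d.*2.+1.
  by apply: leq_trans Nd; rewrite leq_mul2r subset_leq_card ?orbT.
have := HC _ _ P _ (shaded_sub sub HL) Nd' nr'.
have := leq_mul ref (leqnn (field_order F ^ 2)); lia.
Qed.

(** A flat of dimension [d + 1] contains few lines, so the covering needs many rich
    flats, of which about [q / (2 C0)] can be taken with total overlap at most half
    of their total size. If there are fewer than that, all are taken. *)
Lemma greedy (F : finFieldType) n d m C0 (P : {set 'rV[F]_n}) (Ls : {set {set 'rV[F]_n}}) :
  union_bound d m C0 -> shaded m P Ls ->
  #|Ls| * field_order F ^ 2 <= field_order F ^ d.+1.*2.+1 ->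
  (forall L, L \in Ls -> exists2 S, rich d.+1 Ls S & L \subset S) ->
  #|Ls| * field_order F ^ 2 <= (4 * C0 + 4 * C0 ^ 2) * (#|P| * field_order F ^ d.+1).
Proof.
move=> HC HL Nd cov; pose SS := [set S | rich d.+1 Ls S].
have q0 : 0 < field_order F by exact: ltnW (field_gt1 F).
have NJ : #|Ls| * field_order F ^ 2 <= #|SS| * (2 * field_order F ^ d.+1.*2).
  have H1 : #|Ls| <= \sum_(S in SS) #|inside Ls S|.
    have sub : Ls \subset \bigcup_(S in SS) inside Ls S.
      apply/subsetP => L LL; have [S rS LS] := cov L LL.
      by apply/bigcupP; exists S; rewrite inE ?rS ?LL.
    apply: leq_trans (subset_leq_card sub) _.
    elim/big_rec2: _ => [|T a A _ IH]; first by rewrite cards0.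
    by apply: leq_trans (leq_card_setU _ _) _; rewrite leq_add2l.
  rewrite -[X in _ <= X]sum_nat_const; apply: leq_trans (_ : (\sum_(S in SS) #|inside Ls S|) * field_order F ^ 2 <= _).
    by rewrite leq_mul2r H1 orbT.
  rewrite big_distrl; apply: leq_sum => S; rewrite inE => /andP[fS _].
  by apply: inside_bound fS _ => L /HL[].
set q := field_order F in q0 Nd NJ *; set J := #|SS| in NJ.
(* The largest number of flats for which the overlaps stay below one half;
   the successor makes it exceed [q / (2 C0)] in spite of the truncated division. *)
pose t := minn J (q %/ (2 * C0)).+1.
have Ht : t * q ^ d.+1 <= 2 * C0 * #|P|.
  pose s := take t (enum SS).
  have ss : size s = t by rewrite size_takel // -cardE geq_minl.
  have inS : {subset s <= SS} by move=> S /mem_take; rewrite mem_enum.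
  have := @card_bigcup_lower _ s P (q ^ d.+1) (q ^ d) C0.
  rewrite ss take_uniq ?enum_uniq // => /(_ isT) H.
  have {H} : t * q ^ d.+1 <= C0 * (#|P :&: \bigcup_(A <- s) A| + t * t.-1 * q ^ d).
    apply: H => [S /inS|S T /inS + /inS]; rewrite !inE; first exact: rich_card HC HL.
    by move=> /andP[fS _] /andP[fT _] ST; apply: flat_meet.
  have : #|P :&: \bigcup_(A <- s) A| <= #|P| by rewrite subset_leq_card ?subsetIl.
  have tq : 2 * C0 * t.-1 <= q.
    apply: leq_trans (_ : 2 * C0 * (q %/ (2 * C0)) <= _); last by rewrite mulnC leq_trunc_div.
    by rewrite leq_mul2l; apply/orP; right; have := geq_minr J (q %/ (2 * C0)).+1; rewrite -/t; lia.
  have := leq_mul tq (leqnn (t * q ^ d)); rewrite expnS; nia.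
have [tJ|tJ] := leqP J (q %/ (2 * C0)).+1; move: Ht; rewrite /t.
  rewrite (minn_idPl tJ) => Ht; apply: leq_trans NJ _.
  rewrite -addnn expnD; have := leq_mul Ht (leqnn (2 * q ^ d.+1)); lia.
rewrite (minn_idPr (ltnW tJ)) => Ht; apply: leq_trans Nd _.
have [C00|C00] := posnP C0.
  by move: Ht; rewrite C00 !muln0 mul0n divn0 mul1n leqNgt expn_gt0 q0.
have : q <= 2 * C0 * (q %/ (2 * C0)).+1 by rewrite mulnC ltnW // ltn_ceil // muln_gt0.
move: (_.+1) Ht => u Ht qu; rewrite expnS -addnn expnD.
have := leq_mul qu (leqnn (q ^ d.+1 * q ^ d.+1)).
have := leq_mul Ht (leqnn (2 * C0 * q ^ d.+1)); rewrite (mulnDl (4 * C0)); lia.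
Qed.

(** Beyond [q^(2d+1)] lines the minimum no longer grows, so a subcollection of
    exactly that size suffices. *)
Lemma union_bound_small d m C :
  (forall (F : finFieldType) n (P : {set 'rV[F]_n}) Ls, shaded m P Ls ->
    #|Ls| * field_order F ^ 2 <= field_order F ^ d.+1.*2.+1 ->
    #|Ls| * field_order F ^ 2 <= C * (#|P| * field_order F ^ d.+1)) ->
  union_bound d.+1 m C.
Proof.
move=> HC F n P Ls HL.
have [Nd|Nd] := leqP (#|Ls| * field_order F ^ 2) (field_order F ^ d.+1.*2.+1).
  exact: HC.
have q0 : 0 < field_order F by exact: ltnW (field_gt1 F).
have e : field_order F ^ d.*2.+1 * field_order F ^ 2 = field_order F ^ d.+1.*2.+1.
  by rewrite -expnD addn2.
have small : field_order F ^ d.*2.+1 <= #|Ls|.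
  by move: (ltnW Nd); rewrite -e leq_pmul2r // expn_gt0 q0.
have [Ls' sub cLs'] : exists2 Ls' : {set {set 'rV[F]_n}},
    Ls' \subset Ls & #|Ls'| = field_order F ^ d.*2.+1.
  have ss : size (take (field_order F ^ d.*2.+1) (enum Ls)) = field_order F ^ d.*2.+1.
    by rewrite size_takel // -cardE.
  exists [set L in take (field_order F ^ d.*2.+1) (enum Ls)].
    by apply/subsetP => L; rewrite inE => /mem_take; rewrite mem_enum.
  by rewrite cardsE -[RHS]ss; apply/card_uniqP; rewrite take_uniq ?enum_uniq.
have := HC _ _ P _ (shaded_sub sub HL); rewrite cLs' e => /(_ (leqnn _)).
exact.
Qed.

(** The lines are split according to whether they lie in a rich flat of the top
    dimension: [greedy] bounds those that do, and [stage] the others, for which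
    no flat of that dimension can be rich. *)
Lemma union_bound_exists d : forall m, exists C, union_bound d m C.
Proof.
elim/ltn_ind: d => -[|d] IH m; first by exists m; exact: union_bound0.
have [C0 HC0] := IH d (ltnSn d) m.
have [C HC] := stage (fun k kd => IH k kd (2 * m)) (ltnSn d).
exists (2 * C + 2 * (4 * C0 + 4 * C0 ^ 2)); apply: union_bound_small => F n P Ls HL Nd.
pose L1 := [set L in Ls | [exists S : {set 'rV[F]_n}, rich d.+1 Ls S && (L \subset S)]].
have sub1 : L1 \subset Ls by apply/subsetP => L /setIdP[].
have sub2 : Ls :\: L1 \subset Ls by apply: subsetDl.
have small (Ls' : {set {set 'rV[F]_n}}) : Ls' \subset Ls ->
    #|Ls'| * field_order F ^ 2 <= field_order F ^ d.+1.*2.+1.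
  by move=> sub; apply: leq_trans Nd; rewrite leq_mul2r subset_leq_card ?orbT.
have H1 : #|L1| * field_order F ^ 2 <= (4 * C0 + 4 * C0 ^ 2) * (#|P| * field_order F ^ d.+1).
  apply: greedy HC0 (shaded_sub sub1 HL) (small _ sub1) _ => L.
  move=> /setIdP[LL /existsP[S /andP[rS LS]]]; exists S => //.
  case/andP: (rS) => fS; rewrite /rich fS /=.
  suff -> : inside L1 S = inside Ls S by [].
  apply/setP => L'; rewrite !inE; have [LS'|LS'] := boolP (L' \subset S); last by rewrite !andbF.
  rewrite !andbT; have [LL'|//] := boolP (L' \in Ls).
  by apply/existsP; exists S; rewrite rS.
have H2 : #|Ls :\: L1| * field_order F ^ 2 <= C * (#|P| * field_order F ^ d.+1).
  apply: HC (shaded_sub sub2 HL) (small _ sub2) _ => S; apply/negP => /andP[fS].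
  have [->|[L /setIdP[/setDP[LL LL1] LS]]] := set_0Vmem (inside (Ls :\: L1) S).
    by rewrite cards0 leqNgt field_pow_gt0.
  move=> r; case/negP: LL1; rewrite inE LL; apply/existsP; exists S.
  rewrite LS /rich fS /= andbT; apply: leq_trans r _; rewrite leq_mul2r.
  apply/orP; right; apply: subset_leq_card; apply/subsetP => L'.
  by case/setIdP=> /(subsetP sub2) LL' LS'; rewrite inE LL'.
have := cardsID L1 Ls; rewrite (setIidPr sub1) => <-.
rewrite mulnDl (mulnDl (2 * C)) addnC; apply: leq_add.
  by apply: leq_trans H2 _; rewrite leq_mul2r leq_pmull ?orbT.
by apply: leq_trans H1 _; rewrite leq_mul2r leq_pmull ?orbT.
Qed.

(** * Translation into real exponents *)

Local Open Scope ring_scope.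

Lemma is_line_flat (F : finFieldType) n (L : {set 'rV[F]_n}) : is_line L -> flat 1 L.
Proof.
move=> [p [U [dU ->]]].
have [v v0 eU] : exists2 v, v != 0 & U = <[v]>%VS.
  exists (vpick U); first by rewrite vpick0 -dimv_eq0 dU.
  by apply/eqP; rewrite eq_sym eqEdim -memvE memv_pick dim_vline vpick0 -dimv_eq0 dU.
apply/andP; split.
  have -> : [set p + u | u in U] = [set p + a *: v | a : F].
    apply/setP => x; apply/imsetP/imsetP => [[u uU ->]|[a _ ->]].
      by move: uU; rewrite eU => /vlineP[a ->]; exists a.
    by exists (a *: v) => //; rewrite eU memvZ ?memv_line.
  rewrite card_imset ?expn1 //.
  move=> a b /addrI/eqP; rewrite -subr_eq0 -scalerBl scaler_eq0 (negPf v0) orbF.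
  by rewrite subr_eq0 => /eqP.
apply/affineP => x y z a /imsetP[u uU ->] /imsetP[u1 uU1 ->] /imsetP[u2 uU2 ->].
apply/imsetP; exists (u + a *: (u1 - u2)); first by rewrite memvD ?memvZ ?memvB.
by rewrite opprD addrACA subrr add0r addrA.
Qed.

Theorem theorem1p2 (R : realType) (d : nat) (hd : (1 <= d)%N) :
  exists c : R, 0 < c /\
    forall (F : finFieldType) (n : nat) (beta : R)
           (Ls : {set {set 'rV[F]_n}}),
      (0 < n)%N -> 0 <= beta <= 1 ->
      (forall L, L \in Ls -> is_line L) ->
      #|F|%:R `^ (2 * (d%:R - 1) + beta) <= #|Ls|%:R :> R ->
      c * #|F|%:R `^ (d%:R + beta) <= #|(\bigcup_(L in Ls) L)%SET|%:R.
Proof.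
have [C HC] := union_bound_exists d 1.
have C1 : 0 < (C.+1)%:R :> R by rewrite ltr0n.
exists (C.+1)%:R^-1; split; first by rewrite invr_gt0.
move=> F n beta Ls _ /andP[b0 b1] HL HN; set P := \bigcup_(L in Ls) L.
have sh : shaded 1 P Ls.
  move=> L LL; have fL := is_line_flat (HL L LL); split=> //.
  by rewrite (setIidPl (bigcup_sup L LL)) (flat_card fL) expn1 mul1n.
have := HC F n P Ls sh; rewrite /field_order; set q := #|F| in HN *.
have q0 : (0 < q)%N by exact: ltnW (field_gt1 F).
have qR : 0 < q%:R :> R by rewrite ltr0n.
have q1 : 1 <= q%:R :> R by rewrite ler1n.
rewrite -(ler_nat R) => H.
rewrite mulrC ler_pdivrMr //.
have qd : 0 < q%:R ^+ d :> R by rewrite exprn_gt0.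
rewrite -(ler_pM2r qd).
have e1 : q%:R `^ (d%:R + beta) * q%:R ^+ d = q%:R `^ ((d.*2)%:R + beta) :> R.
  rewrite -powR_mulrn ?ler0n // -powRD; last by rewrite pnatr_eq0 -lt0n q0 implybT.
  by congr (_ `^ _); rewrite -addnn natrD addrAC.
rewrite e1; apply: (@le_trans _ _ (minn (#|Ls| * q ^ 2) (q ^ d.*2.+1))%:R); last first.
  apply: le_trans H _; rewrite !natrM natrX mulrA [_ * (C.+1)%:R]mulrC.
  by rewrite ler_pM2r // ler_wpM2r // ler_nat.
rewrite natr_min le_min !natrM !natrX; apply/andP; split.
  apply: le_trans (_ : q%:R `^ (2 * (d%:R - 1) + beta) * q%:R ^+ 2 <= _).
    rewrite -powR_mulrn ?ler0n // -powRD; last by rewrite pnatr_eq0 -lt0n q0 implybT.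
    by rewrite ler_powR // -muln2 natrM; rewrite le_eqVlt; apply/orP; left; apply/eqP; ring.
  by rewrite ler_wpM2r // exprn_ge0 // ltW.
by rewrite -powR_mulrn ?ler0n // ler_powR // -natr1 lerD2l.
Qed.
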